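(* $i(3,\infty)\le 0.454$.
   Context: For a graph $G$, $\alpha(G)$ is its independence number (maximum size of a set of pairwise non-adjacent vertices) and $i(G)=\alpha(G)/|V(G)|$ is its independence ratio. For positive integers $r,g$, $i(r,g)$ denotes the infimum of $i(G)$ over all $r$-regular (simple) graphs $G$ of girth at least $g$, and $i(r,\infty)=\lim_{g\to\infty} i(r,g)$. *)

(* Defs.v *)
From HB Require Import structures.
From mathcomp Require Import all_boot.
From Stdlib Require Import Reals.

Set Implicit Arguments.
Unset Strict Implicit.
Unset Printing Implicit Defensive.

Definition simple_graph (T : finType) (e : rel T) : Prop :=
  symmetric e /\ irreflexive e.

Definition regular (T : finType) (e : rel T) (r : nat) : Prop :=
  forall x : T, #|[set y | e x y]| = r.

Definition independent (T : finType) (e : rel T) (S : {set T}) : bool :=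
  [forall x in S, forall y in S, ~~ e x y].

Definition alpha (T : finType) (e : rel T) : nat :=
  \max_(S : {set T} | independent e S) #|S|.

Definition girth_at_least (T : finType) (e : rel T) (g : nat) : Prop :=
  forall p : seq T, uniq p -> cycle e p -> (3 <= size p)%N -> (g <= size p)%N.

Definition nverts (T : finType) : nat := #|T|.

Open Scope R_scope.

Definition ratio_set (r g : nat) (x : R) : Prop :=
  exists (T : finType) (e : rel T),
    simple_graph e /\ regular e r /\ girth_at_least e g /\ (0 < nverts T)%nat /\
    x = INR (alpha e) / INR (nverts T).

Definition is_inf (E : R -> Prop) (m : R) : Prop :=
  (forall x, E x -> m <= x) /\ (forall b, (forall x, E x -> b <= x) -> b <= m).

(* Main.v *)
(* The upper bound comes from the interpolation method of statistical physics,
   which yields, for all [lam > 1] and [0 < q < 1], the one-step replica bound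
     i(3,oo) * ln lam <= ln (1 + (lam - 1) (1 - q)^3) - 3/2 * ln (1 - (1 - 1/lam) q^2);
   at [lam = 11] and [q = 5/8] it gives about 0.451.

   Each of [n] vertices carries three half-edges. A half-edge may be joined to
   another one, or receive a message, which forbids its vertex to independent
   sets with probability [q]. Let [Phi] be the logarithm of the expectation of
   [lam] to the power the size of a largest allowed independent set. For two
   half-edges at [u] and [v], the edge multiplies the expectation by
   [1 - (1 - 1/lam) <X_u X_v>] and a message at [u] by [1 - (1 - 1/lam) q <X_u>],
   where [X_u] indicates that [u] lies in every largest allowed set. As [- ln (1 - t)]
   has nonnegative Taylor coefficients and Hadamard powers of Gram matrices are
   positive semidefinite, averaging over random free half-edges gives
     E Phi(edge) + E Phi(nothing) <= 2 E Phi(message) - ln (1 - (1 - 1/lam) q^2) + O(1/f)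
   with [f] free half-edges; discarding the pairs that would close a short cycle
   only affects the error term. Exchanging messages for edges step by step leads
   from isolated vertices with about [3 n] messages to a subcubic graph of large
   girth. Copies of that graph indexed by a permutation group, joined through the
   missing half-edges along involutions without short relations, form a cubic
   graph of large girth with no larger independence ratio. *)

Require Import Defs.
From HB Require Import structures.
From Stdlib Require Import Reals.
From mathcomp Require Import Rstruct.
From mathcomp Require Import all_classical all_reals all_analysis.
From mathcomp Require Import all_fingroup all_boot all_order all_algebra.
From mathcomp Require Import ring lra zify.

Set Implicit Arguments.
Unset Strict Implicit.
Unset Printing Implicit Defensive.
Import Order.TTheory GRing.Theory Num.Theory.
Import numFieldNormedType.Exports.

Local Open Scope nat_scope.

(** * Large girth and constrained independent sets *)

Section Graphs.

Variable T : finType.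
Implicit Types (e : rel T) (u v w : T) (S B : {set T}) (p : seq T).

Definition nbrs e u := [set v | e u v].

Definition add_edge e u v : rel T :=
  fun x y => [|| e x y, (x == u) && (y == v) | (x == v) && (y == u)].

Fixpoint ball e d u : {set T} :=
  if d is d'.+1 then \bigcup_(x in ball e d' u) (x |: nbrs e x) else [set u].

Lemma mem_ball_path e d u p :
  path e u p -> size p <= d -> last u p \in ball e d u.
Proof.
elim: d p => [|d IHd] p.
  by case: p => //= _ _; rewrite inE.
elim/last_ind: p => [|p x _] /=.
  move=> _ _; apply/bigcupP; exists u; last by rewrite !inE eqxx.
  exact: (IHd [::]).
rewrite rcons_path size_rcons last_rcons ltnS => /andP[pp ex] sp.
by apply/bigcupP; exists (last u p); [exact: IHd | rewrite !inE ex orbT].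
Qed.

Lemma ballxx e d u : u \in ball e d u.
Proof. exact: (@mem_ball_path e d u [::]). Qed.

Lemma card_ball e d u (r : nat) :
  (forall x, #|nbrs e x| <= r) -> #|ball e d u| <= r.+1 ^ d.
Proof.
move=> degr; elim: d => [|d IHd] /=; first by rewrite cards1.
have card_bigU (A : {set T}) (F : T -> {set T}) :
    #|\bigcup_(x in A) F x| <= \sum_(x in A) #|F x|.
  elim/big_rec2: _ => [|x n C _ le_C]; first by rewrite cards0.
  by rewrite cardsU (leq_trans (leq_subr _ _)) // leq_add2l.
apply: leq_trans (card_bigU _ _) _.
apply: (@leq_trans (\sum_(x in ball e d u) r.+1)).
  apply: leq_sum => x _; rewrite cardsU1 -add1n leq_add //.
  by case: (_ \notin _).
by rewrite sum_nat_const expnSr leq_mul2r IHd orbT.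
Qed.

Lemma add_edge_sym e u v : symmetric e -> symmetric (add_edge e u v).
Proof.
by move=> sym x y; rewrite /add_edge sym; congr (_ || _); rewrite orbC !(andbC (y == _)).
Qed.

Lemma add_edge_irr e u v : u != v -> irreflexive e -> irreflexive (add_edge e u v).
Proof.
move=> uv irr x; rewrite /add_edge irr /=; apply/norP; split.
  by apply: contraNN uv => /andP[/eqP<- /eqP<-].
by apply: contraNN uv => /andP[/eqP<- /eqP<-].
Qed.

Lemma card_nbrs_add_edge e u v x :
  #|nbrs (add_edge e u v) x| <= #|nbrs e x| + (x == u) + (x == v).
Proof.
have sub : nbrs (add_edge e u v) x \subset
    nbrs e x :|: (if x == u then [set v] else set0)
             :|: (if x == v then [set u] else set0).
  apply/subsetP => y; rewrite !inE /add_edge => /or3P[->//|/andP[-> /eqP->]|/andP[-> /eqP->]].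
    by rewrite set11 orbT.
  by rewrite set11 !orbT.
apply: leq_trans (subset_leq_card sub) _.
apply: leq_trans (leq_card_setU _ _) _.
apply: leq_add; last by case: ifP; rewrite ?cards1 ?cards0.
apply: leq_trans (leq_card_setU _ _) _.
by apply: leq_add => //; case: ifP; rewrite ?cards1 ?cards0.
Qed.

Lemma girth_leq e g h : h <= g -> girth_at_least e g -> girth_at_least e h.
Proof. by move=> hg G p up cp sp; apply: leq_trans hg (G p up cp sp). Qed.

Lemma add_edge_avoid e u v x p :
  u \notin x :: p -> path (add_edge e u v) x p = path e x p.
Proof.
elim: p x => //= y p IHp x uNp; rewrite IHp; last first.
  by apply: contra uNp; rewrite !inE => ->; rewrite orbT.
congr (_ && _); rewrite /add_edge; move: uNp; rewrite !inE !negb_or !(eq_sym u).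
by case/and3P=> /negbTE-> /negbTE-> _; rewrite andbF !orbF.
Qed.

(* A cycle through the new edge is that edge followed by a path of [e]: rotated
   to start at one end of the new edge, it never meets that edge again. *)
Lemma girth_add_edge e u v g :
  symmetric e -> girth_at_least e g -> v \notin ball e g u ->
  girth_at_least (add_edge e u v) g.
Proof.
move=> sym G vNu p up cp sp; rewrite leqNgt; apply/negP => lt_pg.
have [uinp|uNp] := boolP (u \in p); last first.
  have cep : cycle e p.
    case: p uNp cp {up sp lt_pg} => //= x p uNp.
    by rewrite add_edge_avoid // !inE mem_rcons inE !negb_or; move: uNp; rewrite !inE negb_or => /andP[-> ->].
  by move: (G p up cep sp); rewrite leqNgt lt_pg.
case: (rot_to uinp) => i q defp.
have uq : uniq (u :: q) by rewrite -defp rot_uniq.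
have cq : cycle (add_edge e u v) (u :: q) by rewrite -defp rot_cycle.
have sq : 2 < size (u :: q) by rewrite -defp size_rot.
have lq : size (u :: q) < g by rewrite -defp size_rot.
case: q uq cq sq lq {defp} => // y q uq cq sq lq.
have [uNq uyq] := andP (uq : (u \notin y :: q) && uniq (y :: q)).
move: cq; rewrite /= rcons_path add_edge_avoid // => /and3P[uy pyq lu].
have vu : u != v by apply: contraNneq vNu => <-; exact: ballxx.
have ey w : w != u -> w != v -> add_edge e u v u w = e u w.
  move=> wu wv; rewrite /add_edge (negbTE vu) (negbTE wv) !andbF andFb !orbF //.
have yu : y != u by apply: contraNneq uNq => ->; rewrite mem_head.
have llu : last y q != u by apply: contraNneq uNq => <-; exact: mem_last.
(* The new edge can only be the closing edge or the first edge of the rotated cycle; either way the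
   rest is a path of [e] joining [u] and [v], too short for [v] to lie outside the ball. *)
have [lv|lNv] := eqVneq (last y q) v.
  have yv : y != v.
    apply/eqP => yv; case: q {lu llu uq lq uNq pyq} sq uyq lv => //= z q _.
    by rewrite -yv => /andP[yN _] lv; rewrite -lv mem_last in yN.
  case/negP: vNu; rewrite -lv -[last y q]/(last u (y :: q)).
  by apply: mem_ball_path; [rewrite /= pyq -(ey y yu yv) uy | do 2!apply: ltnW].
have elu : e (last y q) u.
  by rewrite sym -(ey _ llu lNv) add_edge_sym.
have [yv|yNv] := eqVneq y v.
  case/negP: vNu.
  have pv : path e v (rcons q u) by rewrite rcons_path -yv pyq.
  have := rev_path e v (rcons q u); rewrite last_rcons.
  have -> : path (fun z => e^~ z) v (rcons q u) = path e v (rcons q u).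
    by apply: eq_path => a b; rewrite sym.
  rewrite pv belast_rcons rev_cons => /mem_ball_path mb.
  by rewrite -(last_rcons u (rev q) v) mb // size_rcons size_rev; do 2!apply: ltnW.
have ce : cycle e (u :: y :: q).
  by rewrite /= rcons_path elu pyq -(ey y yu yNv) uy.
have := G _ uq ce sq; by rewrite leqNgt lq.
Qed.

Definition indep_avoid e B S := independent e S && [disjoint S & B].

Definition alpha_avoid e B := \max_(S | indep_avoid e B S) #|S|.

Lemma alpha_avoid0 e : alpha_avoid e set0 = alpha e.
Proof.
by apply: eq_bigl => S; rewrite /indep_avoid disjoint_sym disjoints_subset sub0set andbT.
Qed.

Lemma alpha_avoid_ex e B : exists2 S, indep_avoid e B S & #|S| = alpha_avoid e B.
Proof.
have i0 : indep_avoid e B set0.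
  rewrite /indep_avoid disjoints_subset sub0set andbT.
  by apply/forall_inP => x; rewrite inE.
have card0 : 0 < #|indep_avoid e B| by apply/card_gt0P; exists set0.
by have [S] := eq_bigmax_cond (fun S => #|S|) card0; exists S.
Qed.

Lemma alpha_avoid_max e B S : indep_avoid e B S -> #|S| <= alpha_avoid e B.
Proof. exact: (@leq_bigmax_cond _ (indep_avoid e B) (fun S => #|S|)). Qed.

Lemma indep_subset e S S' : S' \subset S -> independent e S -> independent e S'.
Proof.
move=> /subsetP sub /forall_inP iS; apply/forall_inP => x xS; apply/forall_inP => y yS.
exact: (forall_inP (iS x (sub x xS))) (sub y yS).
Qed.

Lemma disjoint_setU1 u B S : [disjoint S & u |: B] = (u \notin S) && [disjoint S & B].
Proof.
by rewrite !(disjoint_sym S) -disjointU1; apply: eq_disjoint => x; rewrite !inE.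
Qed.

(* One if [u] lies in every maximum independent set avoiding [B], zero otherwise. *)
Definition frozen e B u := alpha_avoid e B - alpha_avoid e (u |: B).

Lemma alpha_avoidU1_le e B u : alpha_avoid e (u |: B) <= alpha_avoid e B.
Proof.
have [S iS <-] := alpha_avoid_ex e (u |: B); apply: alpha_avoid_max.
by move: iS; rewrite /indep_avoid disjoint_setU1 => /and3P[-> _ ->].
Qed.

Lemma frozen_le1 e B u : frozen e B u <= 1.
Proof.
rewrite leq_subLR addnC; have [S /andP[iS dS] <-] := alpha_avoid_ex e B.
rewrite (cardsD1 u) leq_add ?leq_b1 //.
apply: alpha_avoid_max; rewrite /indep_avoid disjoint_setU1 !inE eqxx /=.
rewrite (indep_subset _ iS) ?subD1set //=.
by apply: disjointWl dS; exact: subD1set.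
Qed.

Lemma alpha_avoidU1 e B u : alpha_avoid e B = alpha_avoid e (u |: B) + frozen e B u.
Proof. by rewrite addnC subnK // alpha_avoidU1_le. Qed.

Lemma add_edge_indep e u v S :
  independent (add_edge e u v) S -> independent e S && ~~ ((u \in S) && (v \in S)).
Proof.
move=> iS; apply/andP; split.
  apply/forall_inP => x xS; apply/forall_inP => y yS.
  by move: (forall_inP (forall_inP iS x xS) y yS); apply: contra => exy; rewrite /add_edge exy.
apply/negP => /andP[uS vS]; move: (forall_inP (forall_inP iS u uS) v vS).
by rewrite /add_edge !eqxx orbT.
Qed.

Lemma indep_add_edge e u v S :
  independent e S -> (u \notin S) || (v \notin S) -> independent (add_edge e u v) S.
Proof.
move=> iS uvN; apply/forall_inP => x xS; apply/forall_inP => y yS.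
rewrite /add_edge (negbTE (forall_inP (forall_inP iS x xS) y yS)) /=.
apply/negP => /orP[/andP[/eqP xu /eqP yv]|/andP[/eqP xv /eqP yu]].
  by rewrite -xu -yv xS yS in uvN.
by rewrite -xv -yu xS yS in uvN.
Qed.

(** An independent set of the enlarged graph misses [u] or [v], so its optimum is the larger of the
    two optima with [u] or [v] blocked. It drops exactly when both ends are frozen. *)
Lemma alpha_avoid_add_edge e B u v :
  alpha_avoid e B = alpha_avoid (add_edge e u v) B + frozen e B u * frozen e B v.
Proof.
have reach w : (w == u) || (w == v) ->
    alpha_avoid e (w |: B) <= alpha_avoid (add_edge e u v) B.
  move=> wuv; have [S /andP[iS]] := alpha_avoid_ex e (w |: B).
  rewrite disjoint_setU1 => /andP[wS dS] <-; apply: alpha_avoid_max.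
  rewrite /indep_avoid dS andbT; apply: indep_add_edge => //.
  by case/orP: wuv => /eqP <-; rewrite wS ?orbT.
have upper : exists2 w, (w == u) || (w == v) &
    alpha_avoid (add_edge e u v) B <= alpha_avoid e (w |: B).
  have [S /andP[/add_edge_indep/andP[iS uvS] dS] <-] := alpha_avoid_ex (add_edge e u v) B.
  move: uvS; rewrite negb_and => /orP[uS|vS]; [exists u|exists v]; rewrite ?eqxx ?orbT //;
    by apply: alpha_avoid_max; rewrite /indep_avoid iS disjoint_setU1 dS ?uS ?vS.
have le : alpha_avoid (add_edge e u v) B <= alpha_avoid e B.
  by have [w _ le] := upper; exact: leq_trans le (alpha_avoidU1_le _ _ _).
have ru := reach u; rewrite eqxx in ru; have {}ru := ru isT.
have rv := reach v; rewrite eqxx orbT in rv; have {}rv := rv isT.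
have au := alpha_avoidU1 e B u; have av := alpha_avoidU1 e B v.
have fu := frozen_le1 e B u; have fv := frozen_le1 e B v.
have {upper} lew : (alpha_avoid (add_edge e u v) B <= alpha_avoid e (u |: B)) \/
   (alpha_avoid (add_edge e u v) B <= alpha_avoid e (v |: B)).
  by case: upper => w /orP[]/eqP<-; [left|right].
case: (frozen e B u) fu au => [|[|//]] _; case: (frozen e B v) fv av => [|[|//]] _;
  rewrite ?muln0 ?muln1; lia.
Qed.

End Graphs.

(** * Completing a subcubic graph to a cubic one *)

Section ReducedWords.

Variables (D : finType) (g : nat).
Implicit Types (d : D) (w : seq D).

Definition reduced w := sorted (fun a b => a != b) w.

(** Left multiplication by [d] in the free product of groups of order two indexed by [D], cut off at
    length [g]: words that are not reduced or would become too long stay fixed. *)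
Definition flip d w :=
  if ~~ reduced w then w else
  if ohead w == Some d then behead w else
  if size w < g then d :: w else w.

Lemma reduced_cons d w : reduced (d :: w) = (ohead w != Some d) && reduced w.
Proof. by case: w => //= d' w; rewrite eq_sym. Qed.

Lemma size_flip d w : size w <= g -> size (flip d w) <= g.
Proof.
rewrite /flip => sw; do 2![case: ifP => // _]; last by case: ifP.
by rewrite size_behead; lia.
Qed.

Lemma flipK d w : size w <= g -> flip d (flip d w) = w.
Proof.
move=> sw; rewrite {2}/flip; case: ifP => [nr|/negbFE rw]; first by rewrite /flip nr.
case: ifP => [|hd].
  case: w rw sw => [|d' w] //; rewrite reduced_cons => /andP[hw rw] /= sw /eqP[dd'].
  by rewrite /flip rw /= -dd' (negbTE hw) sw.
case: ifP => sg; last by rewrite /flip rw /= hd sg.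
by rewrite /flip reduced_cons hd rw /= eqxx.
Qed.

Definition bflip d (x : g.-bseq D) : g.-bseq D := insub_bseq g (flip d x).

Lemma val_bflip d x : bflip d x = flip d x :> seq D.
Proof. by rewrite /bflip /insub_bseq insubdK // unfold_in /= size_flip // size_bseq. Qed.

Lemma bflipK d : involutive (bflip d).
Proof. by move=> x; apply: val_inj; rewrite /= !val_bflip flipK // size_bseq. Qed.

Definition swap d : {perm g.-bseq D} := perm (inv_inj (bflipK d)).

Lemma swapE d x : swap d x = bflip d x.
Proof. exact: permE. Qed.

Lemma swapK d x : (x * swap d * swap d)%g = x :> {perm g.-bseq D}.
Proof.
rewrite -mulgA -[RHS]mulg1; congr (_ * _)%g; apply/perm.permP => y.
by rewrite permM !swapE bflipK perm1.
Qed.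

Fixpoint word_perm w : {perm g.-bseq D} :=
  if w is d :: w' then (word_perm w' * swap d)%g else 1%g.

(** Started at the empty word, the letters pile up without cancelling; hence no short nonempty
    reduced word acts as the identity. *)
Lemma word_perm0 w : reduced w -> size w <= g -> word_perm w [bseq] = w :> seq D.
Proof.
elim: w => [|d w IHw]; first by rewrite perm1.
rewrite reduced_cons /= => /andP[hd rw] sw.
by rewrite permM swapE val_bflip (IHw rw (ltnW sw)) /flip rw (negbTE hd) sw.
Qed.

Lemma word_perm_eq1 w : reduced w -> size w <= g -> word_perm w = 1%g -> w = [::].
Proof. by move=> rw sw w1; rewrite -(word_perm0 rw sw) w1 perm1. Qed.

Lemma swap_inj d d' : 0 < g -> swap d = swap d' -> d = d'.
Proof.
move=> g0 dd'.
have : word_perm [:: d] [bseq] = word_perm [:: d'] [bseq] :> seq D by rewrite /= dd'.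
by rewrite !word_perm0 // => -[].
Qed.

Lemma swap_neq1 d x : 0 < g -> (x * swap d)%g != x :> {perm g.-bseq D}.
Proof.
move=> g0; apply/eqP => /(canRL (mulKg x)); rewrite mulVg => d1.
by have /= := @word_perm_eq1 [:: d] isT g0; rewrite mul1g d1 => /(_ erefl).
Qed.

End ReducedWords.

(** * The cubic lift of a subcubic graph *)

Section Completion.

Variables (T : finType) (e : rel T) (g : nat).
Hypotheses (sym : symmetric e) (irr : irreflexive e).
Hypothesis deg3 : forall u, #|nbrs e u| <= 3.
Hypothesis g_gt0 : 0 < g.

Local Notation slot := (T * 'I_3)%type.
Local Notation gT := {perm g.-bseq slot}.
Local Notation vertex := (T * gT)%type.

Definition free_slot (d : slot) := #|nbrs e d.1| + d.2 < 3.

(* Copies of [e] indexed by the permutations; the vertex [d.1] of the copy [x]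
   is joined through each of its free slots [d] to the same vertex of the copy
   [x * swap d]. *)
Definition slot_lift : rel vertex := fun a b =>
  (a.2 == b.2) && e a.1 b.1 ||
  [exists d : slot, [&& free_slot d, a.1 == d.1, b.1 == d.1 & b.2 == (a.2 * swap g d)%g]].

Lemma slot_liftP (a b : vertex) : reflect
  ((a.2 = b.2 /\ e a.1 b.1) \/
   exists d : slot, [/\ free_slot d, a.1 = d.1, b.1 = d.1 & b.2 = (a.2 * swap g d)%g])
  (slot_lift a b).
Proof.
apply: (iffP orP) => -[].
- by case/andP=> /eqP; left.
- by case/existsP=> d /and4P[? /eqP? /eqP? /eqP?]; right; exists d.
- by case=> /eqP-> ->; left.
by case=> d [? ? ? ?]; right; apply/existsP; exists d; apply/and4P; split=> //; apply/eqP.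
Qed.

Lemma slot_lift_sym : symmetric slot_lift.
Proof.
suff imp a b : slot_lift a b -> slot_lift b a by move=> a b; apply/idP/idP; exact: imp.
move=> /slot_liftP[[ab eab]|[d [fd ad bd ab]]]; apply/slot_liftP.
  by left; rewrite sym.
by right; exists d; rewrite ab swapK.
Qed.

Lemma slot_lift_irr : irreflexive slot_lift.
Proof.
move=> a; apply/negP => /slot_liftP[[_]|[d [_ _ _]]]; first by rewrite irr.
by move/esym/eqP; apply/negP; exact: swap_neq1.
Qed.

Lemma slot_lift_regular : regular slot_lift 3.
Proof.
move=> [u x].
pose A := [set (v, x) | v in nbrs e u].
pose I := [set i : 'I_3 | #|nbrs e u| + i < 3].
pose B := [set (u, (x * swap g (u, i))%g) | i in I].
have -> : [set b | slot_lift (u, x) b] = A :|: B.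
  apply/setP => -[v y]; rewrite !inE; apply/slot_liftP/orP => /=.
    case=> [[<- euv]|[[d i] [/= fd ud -> ->]]]; [left|right]; apply/imsetP.
      by exists v; rewrite ?inE.
    by rewrite -ud in fd *; exists i; rewrite ?inE.
  case=> /imsetP[]; first by move=> w; rewrite inE => euw [-> ->]; left.
  by move=> i; rewrite inE => fi [-> ->]; right; exists (u, i).
have dis : A :&: B = set0.
  apply/setP => -[v y]; rewrite !inE; apply/negP => /andP[/imsetP[w _ [_ ->]] /imsetP[i _ [_]]].
  by move/esym/eqP; apply/negP; exact: swap_neq1.
rewrite cardsU dis cards0 subn0 !card_imset; first last.
- by move=> v w [].
- by move=> i j [] /mulgI/swap_inj-/(_ g_gt0) [].
have : #|I| = 3 - #|nbrs e u|.
  rewrite -sum1dep_card; move: (deg3 u); case: #|_| => [|[|[|[|]]]] // _;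
    by rewrite big_mkcond !big_ord_recl big_ord0.
by move: (deg3 u); lia.
Qed.

(** Each copy cuts an independent set of the lift in an independent set of [e]. *)
Lemma alpha_slot_lift : alpha slot_lift <= #|{: gT}| * alpha e.
Proof.
apply/bigmax_leqP => S /forall_inP iS.
rewrite -sum1_card (partition_big snd predT) //= -sum_nat_const.
apply: leq_sum => x _; rewrite sum1dep_card.
set A := [set a in S | a.2 == x].
have fst_inj : {in A &, injective fst}.
  by move=> [u y] [v z]; rewrite !inE /= => /andP[_ /eqP->] /andP[_ /eqP->] ->.
rewrite -(card_in_imset fst_inj); apply: leq_bigmax_cond.
apply/forall_inP => u /imsetP[[u' y]]; rewrite !inE /= => /andP[aS /eqP yx] ->.
apply/forall_inP => v /imsetP[[v' z]]; rewrite !inE /= => /andP[bS /eqP zx] ->.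
move: (forall_inP (iS _ aS) _ bS); apply: contra => euv.
by apply/slot_liftP; left; rewrite yx zx.
Qed.

(** [w] lists the slots crossed, latest first. The last clause locates the latest crossing on the
    path, or says that the path stays in one copy of [e]. *)
Lemma slot_lift_path_word (a : vertex) (q : seq vertex) :
  path slot_lift a q -> uniq (a :: q) ->
  exists w : seq slot,
    [/\ reduced w, size w <= size q, (last a q).2 = (a.2 * word_perm g w)%g &
        if w is d :: _ then
          (exists q1 q2, a :: q = q1 ++ [:: (d.1, ((last a q).2 * swap g d)%g),
                                           (d.1, (last a q).2) & q2])
        else all (fun b => b.2 == a.2) q /\ path e a.1 (map fst q)].
Proof.
elim/last_ind: q => [|q z IHq]; first by exists [::]; rewrite /= mulg1.
rewrite rcons_path -rcons_cons rcons_uniq => /andP[pq lz] /andP[zNq uq].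
have [w [rw sw lw structw]] := IHq pq uq; rewrite last_rcons size_rcons.
case/slot_liftP: lz => [[lz ez]|[d [fd ld zd lz]]].
  exists w; split=> //; [exact: leqW | by rewrite -lz |].
  case: w {rw sw} lw structw => [|d w] lw.
    rewrite all_rcons map_rcons rcons_path -lz => -[aq ->].
    split; first by rewrite lw /= mulg1 eqxx aq.
    by case: q {IHq pq lz zNq uq lw aq} ez => //= b q; rewrite -(last_map fst).
  by case=> q1 [q2 ->]; exists q1, (rcons q2 z); rewrite -lz rcons_cat.
(* Crossing the same slot twice in a row would lead back to a vertex already on the path. *)
have [nr|hd] := boolP (ohead w == Some d).
  case: w nr structw rw sw lw => //= d' w /eqP[->] [q1 [q2 defq]] _ _ _.
  have lastE : last a q = (d.1, (last a q).2) by rewrite [LHS]surjective_pairing ld.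
  have q20 : q2 = [::].
    case: q2 defq => // b q2 defq; move: uq; rewrite defq cat_uniq => /and3P[_ _] /= /and3P[_ + _].
    by rewrite -lastE -[last a q]/(last a (a :: q)) defq last_cat /= mem_last.
  case/negP: zNq; rewrite defq mem_cat [z]surjective_pairing zd lz mem_head orbT //.
exists (d :: w); split.
- by rewrite reduced_cons hd rw.
- exact: sw.
- by rewrite lz lw /= mulgA.
exists (belast a q), [::].
have -> : (d.1, (z.2 * swap g d)%g) = last a q by rewrite lz swapK -ld -surjective_pairing.
by rewrite -zd -surjective_pairing lastI -!cats1 -catA.
Qed.

(** A cycle shorter than [g] spells a short reduced word acting trivially, hence the empty one; it
    stays in one copy and projects to a cycle of [e]. *)
Lemma slot_lift_girth : girth_at_least e g -> girth_at_least slot_lift g.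
Proof.
move=> G [|a q] // up; rewrite /= rcons_path => /andP[pq la] sq; rewrite leqNgt; apply/negP => lt_qg.
have [w [rw sw lw structw]] := slot_lift_path_word pq up.
have no_word v : reduced v -> size v <= (size q).+1 -> a.2 = (a.2 * word_perm g v)%g -> v = [::].
  move=> rv sv av; apply: (word_perm_eq1 rv (leq_trans sv (ltnW lt_qg))).
  by apply: (mulgI a.2); rewrite mulg1.
case/slot_liftP: la => [[la ea]|[d [fd ld ad la]]].
  have w0 : w = [::] by apply: no_word; rewrite // ?leqW // -lw.
  rewrite w0 in structw; case: structw => aq pe.
  have uf : uniq (map fst (a :: q)).
    rewrite map_inj_in_uniq // => b c bq cq bc.
    have snd_a x : x \in a :: q -> x.2 = a.2.
      by rewrite inE => /predU1P[-> //|/(allP aq)/eqP].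
    by rewrite [b]surjective_pairing [c]surjective_pairing bc !snd_a.
  have := G _ uf; rewrite /= rcons_path pe (last_map fst) ea size_map => /(_ isT sq).
  by rewrite leqNgt lt_qg.
(* A closing edge through the latest slot retraces that crossing: the cycle has only two vertices or
   [a] occurs twice. *)
have [hd|hd] := boolP (ohead w == Some d); last first.
  have := @no_word (d :: w); rewrite reduced_cons hd rw /= mulgA -lw -la.
  by move=> /(_ isT sw erefl).
case: w hd structw {rw sw lw} => //= d' w /eqP[->] [q1 [q2 defq]].
have lastE : last a q = (d.1, (last a q).2) by rewrite [LHS]surjective_pairing ld.
have q20 : q2 = [::].
  case: q2 defq => // b q2 defq; move: up; rewrite defq cat_uniq => /and3P[_ _] /= /and3P[_ + _].
  by rewrite -lastE -[last a q]/(last a (a :: q)) defq last_cat /= mem_last.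
have aE : a = (d.1, ((last a q).2 * swap g d)%g) by rewrite [LHS]surjective_pairing ad la.
case: q1 defq => [|b q1] defq.
  by move: sq; have := congr1 size defq; rewrite q20 /= => -[->].
move: up; rewrite defq; case: defq => <- _; rewrite -aE /= mem_cat mem_head orbT //.
Qed.

End Completion.

Lemma cubic_completion (T : finType) (e : rel T) (g : nat) :
  symmetric e -> irreflexive e -> (forall u, #|nbrs e u| <= 3) -> girth_at_least e g ->
  exists (T' : finType) (e' : rel T') (m : nat),
    [/\ simple_graph e', regular e' 3 & girth_at_least e' g] /\
    [/\ 0 < m, #|T'| = m * #|T| & alpha e' <= m * alpha e].
Proof.
move=> sym irr deg3 G.
wlog g0 : g G / 0 < g.
  case: g G => [_|g G]; last by apply.
  have G1 : girth_at_least e 1 by move=> p _ _; apply: leq_trans.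
  move=> /(_ 1 G1 isT) [T' [e' [m [[simple reg _] bounds]]]].
  by exists T', e', m; split.
exists (T * {perm g.-bseq (T * 'I_3)})%type, (@slot_lift T e g), #|{: {perm g.-bseq (T * 'I_3)}}|.
split; split.
- by split; [exact: slot_lift_sym | exact: slot_lift_irr].
- exact: slot_lift_regular.
- exact: slot_lift_girth.
- by apply/card_gt0P; exists 1%g.
- by rewrite card_prod mulnC.
- exact: alpha_slot_lift.
Qed.

Local Open Scope ring_scope.

(** * Positivity of the logarithmic kernel *)

(** Schur's product theorem for Gram matrices: one factor, expanded over [o], is absorbed by
    replacing [c i] with [c i * X i o]; the base case is a square. *)
Lemma hadamard_power_ge0 (R : realDomainType) (I O : finType) (w : O -> R)
    (X : I -> O -> R) (k : nat) (c : I -> R) :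
  (forall o, 0 <= w o) ->
  0 <= \sum_i \sum_j c i * c j * (\sum_o w o * X i o * X j o) ^+ k.
Proof.
move=> w0; elim: k c => [|k IHk] c.
  under eq_bigr do under eq_bigr do rewrite expr0 mulr1.
  under eq_bigr do rewrite -mulr_sumr.
  by rewrite -mulr_suml -expr2 sqr_ge0.
have -> : \sum_i \sum_j c i * c j * (\sum_o w o * X i o * X j o) ^+ k.+1 =
    \sum_o w o * \sum_i \sum_j (c i * X i o) * (c j * X j o) *
      (\sum_o w o * X i o * X j o) ^+ k.
  under [RHS]eq_bigr do rewrite mulr_sumr.
  rewrite [RHS]exchange_big; apply: eq_bigr => i _ /=.
  under [RHS]eq_bigr do rewrite mulr_sumr.
  rewrite [RHS]exchange_big; apply: eq_bigr => j _ /=.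
  by rewrite exprS mulrA mulr_sumr mulr_suml; apply: eq_bigr => o _; ring.
by apply: sumr_ge0 => o _; apply: mulr_ge0.
Qed.

(** The remainder vanishes at 0 and has derivative [x ^+ K / (1 - x)], so the mean value theorem
    applies. *)
Lemma ln_series_remainder (R : realType) (K : nat) (t : R) : 0 <= t -> t < 1 ->
  `|- ln (1 - t) - \sum_(k < K) t ^+ k.+1 / k.+1%:R| <= t ^+ K / (1 - t).
Proof.
move=> t0 t1; have [->|tn0] := eqVneq t 0.
  rewrite subr0 ln1 oppr0 sub0r big1 ?oppr0 ?normr0 ?divr1 ?exprn_ge0 //.
  by move=> k _; rewrite expr0n mul0r.
have {}t0 : 0 < t by rewrite lt_neqAle eq_sym tn0.
pose f : R -> R := - (@ln R \o (cst 1 - id)) - \sum_(k < K) (k.+1%:R^-1 *: (id : R -> R) ^+ k.+1).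
have fE x : f x = - ln (1 - x) - \sum_(k < K) x ^+ k.+1 / k.+1%:R.
  rewrite /f !fctE fct_sumE; congr (- ln _ - _) => //.
  by apply: eq_bigr => k _; rewrite !fctE /GRing.scale /= mulrC.
have df (x : R) : x < 1 -> is_derive x 1 f (x ^+ K / (1 - x)).
  move=> x1; have x10 : 0 < 1 - x by rewrite subr_gt0.
  have dl : is_derive x (1 : R) (@ln R \o (cst (1 : R) - id)) (- (1 - x)^-1).
    have dln := is_derive1_ln x10.
    have dln' : is_derive ((cst (1 : R) - id) x) (1 : R) (@ln R) (1 - x)^-1 by [].
    have db : is_derive x (1 : R) (cst (1 : R) - id) (0 - 1) by exact: is_deriveB.
    by have := is_derive1_comp dln' db; rewrite sub0r mulrN1.
  apply: (@is_derive_eq _ _ _ f x 1 _ _ (is_deriveB _ _)).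
  have -> : \sum_(i < K) i.+1%:R^-1 *: (i.+1%:R * x ^+ i)%:A = (1 - x ^+ K) / (1 - x) :> R.
    rewrite -opprB subrX1 -mulNr opprB mulrAC divff ?gt_eqF // mul1r.
    by apply: eq_bigr => i _; rewrite /GRing.scale /= mulr1 mulKf // pnatr_eq0.
  by field; rewrite gt_eqF.
have [|| c] := MVT t0 (f := f) (df := fun x => x ^+ K / (1 - x)).
- by move=> x; rewrite in_itv /= => /andP[_ xt]; apply: df; exact: lt_trans t1.
- apply: derivable_within_continuous => x; rewrite in_itv /= => /andP[_ xt].
  by have := df x (le_lt_trans xt t1); case.
rewrite in_itv /= => /andP[c0 ct].
have f0 : f 0 = 0.
  rewrite fE subr0 ln1 oppr0 sub0r big1 ?oppr0 // => k _.
  by rewrite expr0n mul0r.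
rewrite f0 !subr0 fE => ->.
have c1 : c < 1 by exact: lt_trans t1.
have cK0 : 0 <= c ^+ K / (1 - c) by rewrite divr_ge0 ?exprn_ge0 ?subr_ge0 // ltW.
rewrite ger0_norm; last exact: mulr_ge0 cK0 (ltW t0).
apply: (@le_trans _ _ (c ^+ K / (1 - c))); first by rewrite ler_piMr // ltW.
apply: ler_pM.
- by rewrite exprn_ge0 // ltW.
- by rewrite invr_ge0 subr_ge0 ltW.
- by rewrite lerXn2r ?nnegrE ?(ltW c0) ?(ltW ct) ?(ltW t0).
- by rewrite lef_pV2 ?posrE ?subr_gt0 // lerB // ltW.
Qed.

(* The power series of [- ln (1 - t)] has nonnegative coefficients. *)
Lemma ln_kernel_ge0 (R : realType) (I : finType) (c : I -> R) (M : I -> I -> R) (kap : R) :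
  0 <= kap < 1 -> (forall i j, 0 <= M i j <= 1) ->
  (forall k, 0 <= \sum_i \sum_j c i * c j * M i j ^+ k) ->
  0 <= \sum_i \sum_j c i * c j * - ln (1 - kap * M i j).
Proof.
move=> /andP[k0 k1] M01 pow_ge0.
set S := \sum_i \sum_j _.
pose A := \sum_i \sum_j `|c i * c j|.
have A0 : 0 <= A by do 2![apply: sumr_ge0 => ? _].
have k10 : 0 < 1 - kap by rewrite subr_gt0.
(* The series truncated at [K] contributes a nonnegative sum [SK]; the remainder tends to zero as
   [K] grows. *)
have lowS K : - (A / (1 - kap) * kap ^+ K) <= S.
  pose SK := \sum_i \sum_j c i * c j * \sum_(k < K) (kap * M i j) ^+ k.+1 / k.+1%:R.
  have SK0 : 0 <= SK.
    have -> : SK = \sum_(k < K) kap ^+ k.+1 / k.+1%:R *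
        \sum_i \sum_j c i * c j * M i j ^+ k.+1.
      under [RHS]eq_bigr do rewrite mulr_sumr; rewrite [RHS]exchange_big.
      apply: eq_bigr => i _; under [RHS]eq_bigr do rewrite mulr_sumr.
      rewrite [RHS]exchange_big; apply: eq_bigr => j _; rewrite mulr_sumr.
      by apply: eq_bigr => k _; rewrite exprMn; ring.
    by apply: sumr_ge0 => k _; rewrite !mulr_ge0 ?exprn_ge0 ?invr_ge0.
  apply: (@le_trans _ _ (S - SK)); last by rewrite gerBl.
  rewrite lerNl opprB /SK /S -sumrB /A 2!mulr_suml; apply: ler_sum => i _.
  rewrite -sumrB 2!mulr_suml; apply: ler_sum => j _.
  rewrite -mulrBr; apply: le_trans (ler_norm _) _; rewrite normrM -!mulrA.
  apply: ler_wpM2l => //; rewrite distrC.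
  have /andP[M0 M1] := M01 i j.
  have kM : kap * M i j <= kap by rewrite ler_piMr.
  have kM0 : 0 <= kap * M i j by rewrite mulr_ge0.
  apply: le_trans (ln_series_remainder _ kM0 (le_lt_trans kM k1)) _.
  rewrite mulrC; apply: ler_pM.
  - by rewrite invr_ge0 subr_ge0 ltW // (le_lt_trans kM).
  - exact: exprn_ge0.
  - by rewrite lef_pV2 ?posrE ?subr_gt0 ?(le_lt_trans kM k1) // lerB.
  by rewrite lerXn2r ?nnegrE.
have normk : `|kap| < 1 by rewrite ger0_norm.
have cv := cvgN (cvgMl_tmp (a := A / (1 - kap)) (cvg_expr normk)).
rewrite mulr0 oppr0 in cv.
by apply: (cvgr_to_le (cv _ _)); near=> K; exact: lowS.
Unshelve. all: by end_near.
Qed.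

(** * Interpolation *)

Section Interpolation.

Variables (R : realType) (lam q : R) (T : finType) (g : nat).
Hypotheses (lam1 : 1 < lam) (q0 : 0 < q) (q1 : q < 1).
Implicit Types (e : rel T) (s : seq T) (B : {set T}) (u v : T).

Local Notation kap := (1 - lam^-1).

Let lam0 : 0 < lam. Proof. exact: lt_trans lam1. Qed.
Let lnlam0 : 0 < ln lam. Proof. exact: ln_gt0. Qed.
Let kap0 : 0 < kap. Proof. by rewrite subr_gt0 invf_lt1. Qed.
Let kap1 : kap < 1. Proof. by rewrite ltrBlDr ltrDl invr_gt0. Qed.

(* Expectation of [F] at the set of blocked vertices when each message in [s]
   independently blocks its vertex with probability [q]. *)
Fixpoint blockE s (F : {set T} -> R) : R :=
  if s is u :: s' then blockE s' (fun B => (1 - q) * F B + q * F (u |: B)) else F set0.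

(** A finite sample space, which reduces linearity and monotonicity of [blockE] to those of finite
    sums. *)
Lemma blockE_sum s : exists (Om : finType) (w : Om -> R) (b : Om -> {set T}),
  (forall o, 0 <= w o) /\ (forall F, blockE s F = \sum_o w o * F (b o)).
Proof.
elim: s => [|u s [Om [w [b [w0 sumE]]]]].
  by exists unit, (fun=> 1), (fun=> set0); split=> // F; rewrite (big_pred1 tt) ?mul1r //; case.
exists (Om * bool)%type, (fun o => w o.1 * (if o.2 then q else 1 - q)),
  (fun o => if o.2 then u |: b o.1 else b o.1); split.
  by move=> [x d]; case: d => /=; rewrite mulr_ge0 ?subr_ge0 // ltW.
move=> F; rewrite /= sumE.
rewrite -(pair_bigA _ (fun o (i : bool) => w o * (if i then q else 1 - q) *
   F (if i then u |: b o else b o))) /=.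
by apply: eq_bigr => o _; rewrite big_bool /=; ring.
Qed.

Lemma eq_blockE s F G : F =1 G -> blockE s F = blockE s G.
Proof. by move=> /funext ->. Qed.

Lemma blockE_le s F G : (forall B, F B <= G B) -> blockE s F <= blockE s G.
Proof.
move=> FG; have [Om [w [b [w0 sumE]]]] := blockE_sum s.
by rewrite !sumE; apply: ler_sum => o _; exact: ler_wpM2l.
Qed.

Lemma blockE_cst s (c : R) : blockE s (fun=> c) = c.
Proof.
elim: s => //= u s IHs; rewrite -[RHS]IHs; apply: eq_blockE => B; ring.
Qed.

Definition weight e B : R := lam ^+ alpha_avoid e B.

Definition fz e u B : R := (frozen e B u)%:R.

Lemma weight_ge1 e B : 1 <= weight e B.
Proof. by rewrite exprn_ege1 // ltW. Qed.

Lemma fz01 e u B : fz e u B = 0 \/ fz e u B = 1.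
Proof. by have := frozen_le1 e B u; rewrite /fz; case: frozen => [|[]] //; [left|right]. Qed.

(** Blocking a frozen vertex costs one unit of the optimum, hence a factor [1 - kap], that is
    [lam^-1]. *)
Lemma weight_block e B u : weight e (u |: B) = weight e B * (1 - kap * fz e u B).
Proof.
rewrite /weight (alpha_avoidU1 e B u) /fz; have := frozen_le1 e B u.
case: frozen => [|[|//]] _; rewrite ?addn0 ?mulr0 ?subr0 ?mulr1 //.
by rewrite addn1 exprSr opprB addrC subrK mulfK // gt_eqF.
Qed.

Lemma weight_add_edge e B u v :
  weight (add_edge e u v) B = weight e B * (1 - kap * (fz e u B * fz e v B)).
Proof.
rewrite /weight (alpha_avoid_add_edge e B u v) /fz -natrM.
have := frozen_le1 e B u; have := frozen_le1 e B v.
case: (frozen e B u) => [|[|//]]; case: (frozen e B v) => [|[|//]] _ _;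
  rewrite ?muln0 ?mul0n ?addn0 ?mulr0 ?subr0 ?mulr1 //.
by rewrite muln1 addn1 exprSr opprB addrC subrK mulfK // gt_eqF.
Qed.

Definition Phi e s : R := ln (blockE s (weight e)).

Lemma blockE_weight_ge1 e s : 1 <= blockE s (weight e).
Proof. by rewrite -(blockE_cst s 1); apply: blockE_le => B; exact: weight_ge1. Qed.

Lemma Phi_ge0 e s : 0 <= Phi e s.
Proof. exact: ln_ge0 (blockE_weight_ge1 e s). Qed.

Lemma Phi_nil e : Phi e [::] = (alpha e)%:R * ln lam.
Proof. by rewrite /Phi /= /weight alpha_avoid0 lnXn // mulr_natl. Qed.

(** The mean over random blocked sets, tilted by [weight]; it is not a measure on independent
    sets. *)
Definition gibbs e s (F : {set T} -> R) : R :=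
  blockE s (fun B => weight e B * F B) / blockE s (weight e).

Lemma gibbs_itv e s F : (forall B, 0 <= F B <= 1) -> 0 <= gibbs e s F <= 1.
Proof.
move=> F01; have Z0 : 0 < blockE s (weight e) by exact: lt_le_trans (blockE_weight_ge1 e s).
have W0 B : 0 <= weight e B by exact: le_trans (weight_ge1 e B).
rewrite divr_ge0 ?(ltW Z0) ?ler_pdivrMr // ?mul1r; last first.
  by rewrite -(blockE_cst s 0); apply: blockE_le => B; rewrite mulr_ge0 //; case/andP: (F01 B).
by apply: blockE_le => B; rewrite ler_piMr //; case/andP: (F01 B).
Qed.

Lemma blockE_tilt e s F (k : R) :
  blockE s (fun B => weight e B * (1 - k * F B)) = blockE s (weight e) * (1 - k * gibbs e s F).
Proof.
have Z0 : 0 < blockE s (weight e) by exact: lt_le_trans (blockE_weight_ge1 e s).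
have -> : blockE s (weight e) * (1 - k * gibbs e s F) =
   blockE s (weight e) - k * blockE s (fun B => weight e B * F B).
  by rewrite /gibbs; field; rewrite gt_eqF.
have [Om [w [b [w0 sumE]]]] := blockE_sum s.
rewrite !sumE mulr_sumr -sumrB; apply: eq_bigr => o _; ring.
Qed.

Lemma Phi_msg e s u : Phi e (u :: s) = Phi e s + ln (1 - kap * q * gibbs e s (fz e u)).
Proof.
have Z0 : 0 < blockE s (weight e) by exact: lt_le_trans (blockE_weight_ge1 e s).
rewrite /Phi /= -lnM ?posrE //; last first.
  have /andP[m0 m1] : 0 <= gibbs e s (fz e u) <= 1.
    by apply: gibbs_itv => B; case: (fz01 e u B) => ->; rewrite ?lexx ?ler01.
  have : kap * q < 1 by rewrite (lt_trans _ kap1) // gtr_pMr.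
  have : 0 < kap * q by rewrite mulr_gt0.
  by nra.
congr ln; rewrite -blockE_tilt; apply: eq_blockE => B; rewrite weight_block; ring.
Qed.

Lemma gibbs_fz2_itv e s u v : 0 <= gibbs e s (fun B => fz e u B * fz e v B) <= 1.
Proof.
by apply: gibbs_itv => B; case: (fz01 e u B) => ->; case: (fz01 e v B) => ->;
  rewrite ?mulr0 ?mulr1 ?lexx ?ler01.
Qed.

Lemma Phi_add_edge e s u v :
  Phi (add_edge e u v) s = Phi e s + ln (1 - kap * gibbs e s (fun B => fz e u B * fz e v B)).
Proof.
have Z0 : 0 < blockE s (weight e) by exact: lt_le_trans (blockE_weight_ge1 e s).
rewrite /Phi -lnM ?posrE //; last first.
  have /andP[m0 m1] := gibbs_fz2_itv e s u v.
  by rewrite subr_gt0; apply: le_lt_trans kap1; rewrite ler_piMr // ltW.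
congr ln; rewrite -blockE_tilt; apply: eq_blockE => B; exact: weight_add_edge.
Qed.

Local Notation half := (T * 'I_3)%type.
Implicit Types (F : {set half}) (a b : half).

(* The second moments of the variables [fz] and of the constant [q] form a Gram
   matrix, to which [ln_kernel_ge0] applies. *)
Lemma gram_ineq e s F :
  \sum_(a in F) \sum_(b in F) ln (1 - kap * gibbs e s (fun B => fz e a.1 B * fz e b.1 B)) <=
  2 * #|F|%:R * (\sum_(a in F) ln (1 - kap * q * gibbs e s (fz e a.1)))
    - #|F|%:R ^+ 2 * ln (1 - kap * q ^+ 2).
Proof.
pose Y (i : half + unit) (B : {set T}) : R := if i is inl a then fz e a.1 B else q.
(* With these coefficients, of sum zero, nonnegativity of the quadratic form is the claim
   rearranged. *)
pose c (i : half + unit) : R := if i is inl a then (a \in F)%:R else - #|F|%:R.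
pose M i j := gibbs e s (fun B => Y i B * Y j B).
have Y01 i B : 0 <= Y i B <= 1.
  by case: i => [a|_] /=; [case: (fz01 e a.1 B) => ->; rewrite ?lexx ?ler01 | rewrite !ltW].
have M01 i j : 0 <= M i j <= 1.
  apply: gibbs_itv => B; have /andP[? ?] := Y01 i B; have /andP[? ?] := Y01 j B.
  by rewrite mulr_ge0 // mulr_ile1.
have pow_ge0 k : 0 <= \sum_i \sum_j c i * c j * M i j ^+ k.
  have [Om [w [b [w0 sumE]]]] := blockE_sum s.
  have ME i j : M i j = \sum_o (w o * weight e (b o) / blockE s (weight e)) * Y i (b o) * Y j (b o).
    by rewrite /M /gibbs sumE mulr_suml; apply: eq_bigr => o _; ring.
  under eq_bigr do under eq_bigr do rewrite ME.
  apply: (hadamard_power_ge0 (fun i o => Y i (b o))) => o.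
  rewrite divr_ge0 ?mulr_ge0 ?(le_trans _ (weight_ge1 _ _)) //.
  exact: le_trans (blockE_weight_ge1 e s).
have kap01 : 0 <= kap < 1 by rewrite ltW.
have := ln_kernel_ge0 kap01 M01 pow_ge0.
have sumF (h : half -> R) : \sum_a (a \in F)%:R * h a = \sum_(a in F) h a.
  by rewrite [RHS]big_mkcond; apply: eq_bigr => a _; case: (a \in F); rewrite ?mul1r ?mul0r.
have Mq a : M (inr tt) (inl a) = q * gibbs e s (fz e a.1).
  rewrite /M /gibbs mulrA; congr (_ / _).
  have [Om [w [b [w0 sumE]]]] := blockE_sum s.
  by rewrite !sumE mulr_sumr; apply: eq_bigr => o _ /=; ring.
have Mq' a : M (inl a) (inr tt) = q * gibbs e s (fz e a.1).
  by rewrite -Mq; congr (gibbs e s _); apply: funext => B; rewrite mulrC.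
have Mqq : M (inr tt) (inr tt) = q ^+ 2.
  have Z0 : 0 < blockE s (weight e) by exact: lt_le_trans (blockE_weight_ge1 e s).
  rewrite /M /gibbs; apply: (canLR (mulfK _)); first by rewrite gt_eqF.
  have [Om [w [b [w0 sumE]]]] := blockE_sum s.
  by rewrite !sumE mulr_sumr; apply: eq_bigr => o _ /=; ring.
have sum1 (h : unit -> R) : \sum_x h x = h tt by rewrite (big_pred1 tt) //; case.
rewrite big_sumType sum1 /=; under eq_bigr do rewrite big_sumType sum1 /=.
rewrite big_sumType sum1 /=.
have E1 : \sum_a \sum_b (a \in F)%:R * (b \in F)%:R * - ln (1 - kap * M (inl a) (inl b)) =
    - \sum_(a in F) \sum_(b in F) ln (1 - kap * M (inl a) (inl b)).
  rewrite -sumrN -sumF; apply: eq_bigr => a _.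
  rewrite -sumrN -sumF mulr_sumr; apply: eq_bigr => b _; ring.
have E2 : \sum_a (a \in F)%:R * (1 *- #|F|) * - ln (1 - kap * M (inl a) (inr tt)) =
    #|F|%:R * \sum_(a in F) ln (1 - kap * q * gibbs e s (fz e a.1)).
  by rewrite mulr_sumr -sumF; apply: eq_bigr => a _; rewrite Mq' [kap * (q * _)]mulrA; ring.
have E3 : \sum_a 1 *- #|F| * (a \in F)%:R * - ln (1 - kap * M (inr tt) (inl a)) =
    #|F|%:R * \sum_(a in F) ln (1 - kap * q * gibbs e s (fz e a.1)).
  by rewrite mulr_sumr -sumF; apply: eq_bigr => a _; rewrite Mq [kap * (q * _)]mulrA; ring.
rewrite big_split /= E1 E2 E3 Mqq {E1 E2 E3 Mqq Mq Mq' sumF sum1 pow_ge0 M01 kap01}.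
by rewrite /M /=; lra.
Qed.

End Interpolation.

(** * Random edge and message operators *)

Section Operators.

Variables (R : realType) (lam q : R) (T : finType) (g : nat).
Hypotheses (lam1 : 1 < lam) (q0 : 0 < q) (q1 : q < 1).

Local Notation half := (T * 'I_3)%type.
Local Notation kap := (1 - lam^-1).
Implicit Types (e : rel T) (s : seq T) (F : {set half}) (a b : half) (u v : T).

(* A state consists of a graph, of the set of its free half-edges, where [(v, i)]
   is the [i]-th of the three half-edges at [v], and of the messages sent. *)
Definition state_fun := rel T -> {set half} -> seq T -> R.
Implicit Types G H : state_fun.

Definition Phi_fun : state_fun := fun e _ s => Phi lam q e s.

(* A pair that would create a short cycle is used up without adding its edge,
   so that large girth is an invariant of the process. *)
Definition far_edge e u v : rel T := if v \in ball e g u then e else add_edge e u v.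

(** As transition operators of a Markov chain, [msg_op] and [edge_op] compose with the outermost one
    acting first in time. *)
Definition msg_op G : state_fun := fun e F s =>
  (\sum_(a in F) G e (F :\ a) (a.1 :: s)) / #|F|%:R.

Definition edge_op G : state_fun := fun e F s =>
  (\sum_(a in F) \sum_(b in F :\ a) G (far_edge e a.1 b.1) (F :\ a :\ b) s)
    / (#|F| * #|F|.-1)%:R.

Lemma card_setD1 F a (n : nat) : #|F| = n.+1 -> a \in F -> #|F :\ a| = n.
Proof. by rewrite (cardsD1 a F) => + aF; rewrite aF => -[]. Qed.

(** Both orders average over ordered triples of distinct free half-edges, and [far_edge] does not
    depend on messages. *)
Lemma edge_msg_opC G : edge_op (msg_op G) = msg_op (edge_op G).
Proof.
apply: funext => e; apply: funext => F; apply: funext => s; rewrite /edge_op /msg_op.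
have cD n F' a : #|F'| = n -> a \in F' -> #|F' :\ a| = n.-1.
  by move=> <- aF; rewrite (cardsD1 a F') aF.
pose f := #|F|.
transitivity ((\sum_(a in F) \sum_(b in F :\ a) \sum_(c in F :\ a :\ b)
    G (far_edge e a.1 b.1) (F :\ a :\ b :\ c) (c.1 :: s)) / (f * f.-1 * f.-2)%:R).
  rewrite [(f * _ * _)%:R]natrM invfM mulrA [RHS]mulrAC; congr (_ / _); rewrite mulr_suml.
  apply: eq_bigr => a aF; rewrite mulr_suml; apply: eq_bigr => b bF.
  by rewrite (cD f.-1) // (cD f).
transitivity ((\sum_(c in F) \sum_(a in F :\ c) \sum_(b in F :\ c :\ a)
    G (far_edge e a.1 b.1) (F :\ c :\ a :\ b) (c.1 :: s)) / (f * f.-1 * f.-2)%:R); last first.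
  rewrite -mulnA [(f * _)%:R]natrM invfM mulrA [LHS]mulrAC; congr (_ / _); rewrite mulr_suml.
  by apply: eq_bigr => c cF; rewrite (cD f).
congr (_ / _).
under eq_bigr => a aF.
  rewrite (exchange_big_dep (mem (F :\ a))) /=; last first.
    by move=> b c _; rewrite !inE => /and3P[_ -> ->].
  over.
rewrite (exchange_big_dep (mem F)) /=; last by move=> a c _; rewrite !inE => /andP[].
apply: eq_bigr => c cF; apply: eq_big => [a|a /andP[aF caF]].
  by rewrite !inE cF andbT [in RHS]andbC eq_sym.
apply: eq_big => [b|b _].
  move: caF; rewrite !inE => /andP[ca _]; rewrite (eq_sym c b) ca cF andbT.
  by do ![case: (_ != _)]; case: (_ \in _).
by congr (G _ _ _); apply/setP => x; rewrite !inE; do ![case: (_ != _)].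
Qed.

(** An inequality for the degrees, since half-edges spent on messages or discarded pairs are
    lost. *)
Definition valid e F : Prop :=
  [/\ symmetric e, irreflexive e, girth_at_least e g &
      forall v, (#|nbrs e v| + #|[set a in F | a.1 == v]| <= 3)%N].

Lemma valid_sub e F F' : F' \subset F -> valid e F -> valid e F'.
Proof.
move=> /subsetP sub [sym irr G deg]; split=> // v; apply: leq_trans (deg v).
rewrite leq_add2l; apply: subset_leq_card; apply/subsetP => x.
by rewrite !inE => /andP[/sub-> ->].
Qed.

Lemma valid_far_edge e F a b : valid e F -> a \in F -> b \in F :\ a ->
  valid (far_edge e a.1 b.1) (F :\ a :\ b).
Proof.
move=> V aF bF; rewrite /far_edge; case: ifPn => [_|far].
  by apply: valid_sub V; apply/subsetP => x; rewrite !inE => /and3P[].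
case: V => sym irr G deg; split.
- exact: add_edge_sym.
- by apply: add_edge_irr => //; apply: contraNneq far => ->; exact: ballxx.
- exact: girth_add_edge.
move=> v; apply: leq_trans (deg v).
apply: leq_trans (leq_add (card_nbrs_add_edge _ _ _ _) (leqnn _)) _.
rewrite -!addnA leq_add2l.
rewrite (cardsD1 a [set x in F | x.1 == v]) (cardsD1 b (_ :\ a)).
rewrite !inE aF /=; move: bF; rewrite !inE => /andP[-> ->] /=.
rewrite !(eq_sym v) !leq_add2l; apply: subset_leq_card; apply/subsetP => x.
by rewrite !inE => /andP[/and3P[-> -> ->] ->].
Qed.

Let lam0 : 0 < lam. Proof. exact: lt_trans lam1. Qed.
Let lnlam0 : 0 < ln lam. Proof. exact: ln_gt0. Qed.
Let kap0 : 0 < kap. Proof. by rewrite subr_gt0 invf_lt1. Qed.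
Let kap1 : kap < 1. Proof. by rewrite ltrBlDr ltrDl invr_gt0. Qed.

Definition pair_gain e s a b : R :=
  ln (1 - kap * gibbs lam q e s (fun B => fz R e a.1 B * fz R e b.1 B)).

Lemma pair_gain_itv e s a b : - ln lam <= pair_gain e s a b <= 0.
Proof.
have /andP[m0 m1] := gibbs_fz2_itv lam1 q0 q1 e s a.1 b.1.
have low : lam^-1 <= 1 - kap * gibbs lam q e s (fun B => fz R e a.1 B * fz R e b.1 B).
  by rewrite lerBrDl -lerBrDr ler_piMr // ltW.
rewrite /pair_gain -lnV ?posrE // ler_ln ?posrE ?invr_gt0 ?(lt_le_trans _ low) ?invr_gt0 // low /=.
by rewrite ln_le0 // gerBl mulr_ge0 // ltW.
Qed.

(** A discarded pair leaves [Phi] unchanged, while its edge would have lowered it by at most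
    [ln lam]. *)
Lemma far_edge_Phi_le e F F' a b s :
  Phi_fun (far_edge e a.1 b.1) F' s - Phi_fun e F s <=
    pair_gain e s a b + ln lam * (b.1 \in ball e g a.1)%:R.
Proof.
have /andP[low _] := pair_gain_itv e s a b.
rewrite /far_edge /Phi_fun; case: ifP => _.
  by rewrite subrr mulr1 -lerBlDr sub0r.
by rewrite Phi_add_edge // mulr0 addr0 addrAC subrr add0r.
Qed.

Lemma far_edge_Phi_noninc e F F' a b s :
  Phi_fun (far_edge e a.1 b.1) F' s - Phi_fun e F s <= 0.
Proof.
have /andP[_ up] := pair_gain_itv e s a b.
rewrite /far_edge /Phi_fun; case: ifP => _; first by rewrite subrr.
by rewrite Phi_add_edge // addrAC subrr add0r.
Qed.

(** Three half-edges at each vertex of a ball of radius [g] in a subcubic graph. *)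
Definition near_bound : nat := 3 * 4 ^ g.

Lemma card_near e F u : (forall v, #|nbrs e v| <= 3)%N ->
  \sum_(b in F) (b.1 \in ball e g u)%:R <= near_bound%:R :> R.
Proof.
move=> deg; rewrite -natr_sum ler_nat.
apply: (@leq_trans #|finset.setX (ball e g u) [set: 'I_3]|).
  rewrite -sum1_card big_mkcond [X in (_ <= X)%N]big_mkcond; apply: leq_sum => -[x i] _ /=.
  by rewrite !inE andbT; case: (_ \in F); case: (_ \in _).
by rewrite cardsX cardsT card_ord mulnC leq_mul2l /= card_ball.
Qed.

(* The second term pays for the pairs that [far_edge] discards. *)
Definition step_const (f : R) : R :=
  - ln (1 - kap * q ^+ 2) + near_bound%:R * ln lam / f.

Lemma edge_msg_step e F s : valid e F -> (2 <= #|F|)%N ->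
  edge_op Phi_fun e F s + Phi_fun e F s <=
  2 * msg_op Phi_fun e F s + step_const #|F|%:R.
Proof.
move=> [_ _ _ deg] F2.
pose f : R := #|F|%:R; pose P0 := Phi_fun e F s.
have f0 : 0 < f by rewrite ltr0n (leq_trans _ F2).
have f1 : 0 < f - 1 by rewrite subr_gt0 ltr1n.
pose L := \sum_(a in F) ln (1 - kap * q * gibbs lam q e s (fz R e a.1)).
have msgE : msg_op Phi_fun e F s = P0 + L / f.
  rewrite /msg_op /Phi_fun; under eq_bigr do rewrite Phi_msg //.
  rewrite big_split /= sumr_const -/L -mulr_natr -/f -[Phi _ _ e s]/P0.
  by field; exact: lt0r_neq0.
pose D := \sum_(a in F) \sum_(b in F :\ a)
  (Phi_fun (far_edge e a.1 b.1) (F :\ a :\ b) s - P0).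
have edgeE : edge_op Phi_fun e F s = P0 + D / (f * (f - 1)).
  rewrite /edge_op natrM -subn1 natrB ?(leq_trans _ F2) // -/f.
  have -> : D = \sum_(a in F) \sum_(b in F :\ a) Phi_fun (far_edge e a.1 b.1) (F :\ a :\ b) s
      - f * (f - 1) * P0.
    rewrite /D; under eq_bigr => a aF.
      rewrite sumrB sumr_const (_ : #|_| = #|F|.-1); last by rewrite (cardsD1 a F) aF.
      over.
    rewrite sumrB sumr_const -!mulrnA -mulr_natl natrM -subn1 natrB ?(leq_trans _ F2) //.
    by rewrite -/f; congr (_ - _); ring.
  by field; rewrite !lt0r_neq0.
have D0 : D <= 0 by do 2![apply: sumr_le0 => ? _]; exact: far_edge_Phi_noninc.
have DL : D <= 2 * f * L - f ^+ 2 * ln (1 - kap * q ^+ 2) + f * (near_bound%:R * ln lam).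
  apply: le_trans (lerD (gram_ineq lam1 q0 q1 e s F) (lexx _)).
  have -> : f * (near_bound%:R * ln lam) = \sum_(a in F) ln lam * near_bound%:R.
    by rewrite [RHS]sumr_const -[RHS]mulr_natl -/f [ln lam * _]mulrC.
  rewrite -big_split /=; apply: ler_sum => a aF.
  apply: (@le_trans _ _ (\sum_(b in F) (pair_gain e s a b + ln lam * (b.1 \in ball e g a.1)%:R))).
    (* [gram_ineq] includes the diagonal [b = a], which no edge uses; as [a.1] lies in its own ball,
       the error term covers it. *)
    rewrite [leRHS](big_setD1 a) //= -[leLHS]add0r; apply: lerD.
      have /andP[low _] := pair_gain_itv e s a a.
      by rewrite ballxx mulr1 -lerBlDr sub0r.
    by apply: ler_sum => b _; exact: far_edge_Phi_le.
  rewrite big_split /= lerD2l -mulr_sumr ler_wpM2l ?(ltW lnlam0) //.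
  by apply: card_near => v; apply: leq_trans (deg v); exact: leq_addr.
rewrite msgE edgeE /step_const -/f -/P0.
(* Since [D <= 0], enlarging the denominator increases the quotient. *)
have DD : D / (f * (f - 1)) <= D / (f * f).
  rewrite ler_wnM2l // lef_pV2 ?posrE ?mulr_gt0 // ler_pM2l //.
  by rewrite gerBl.
have DB : D / (f * f) <=
    2 * (L / f) - ln (1 - kap * q ^+ 2) + near_bound%:R * ln lam / f.
  have -> : 2 * (L / f) - ln (1 - kap * q ^+ 2) + near_bound%:R * ln lam / f =
      (2 * f * L - f ^+ 2 * ln (1 - kap * q ^+ 2) + f * (near_bound%:R * ln lam)) / (f * f).
    by field; rewrite lt0r_neq0.
  by rewrite ler_pM2r // invr_gt0 mulr_gt0.
move: (le_trans DD DB); lra.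
Qed.

(** Indexed by the exact pool size, since a message uses one free half-edge and an edge two. *)
Definition dominated (f : nat) (c : R) G1 G2 H := forall e F s,
  valid e F -> #|F| = f -> G1 e F s + G2 e F s <= 2 * H e F s + c.

Lemma dominated_msg f c G1 G2 H : dominated f c G1 G2 H ->
  dominated f.+1 c (msg_op G1) (msg_op G2) (msg_op H).
Proof.
move=> dom e F s V cF; rewrite /msg_op cF.
have f0 : 0 < f.+1%:R :> R by [].
rewrite -mulrDl -big_split /= mulrA -(ler_pM2r f0) mulrDl !mulfVK ?lt0r_neq0 //.
have -> : c * f.+1%:R = \sum_(a in F) c by rewrite sumr_const cF mulr_natr.
rewrite mulr_sumr -big_split /=; apply: ler_sum => a aF.
by apply: dom; [apply: valid_sub V; exact: subD1set | exact: card_setD1 aF].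
Qed.

Lemma dominated_edge f c G1 G2 H : dominated f c G1 G2 H ->
  dominated f.+2 c (edge_op G1) (edge_op G2) (edge_op H).
Proof.
move=> dom e F s V cF; rewrite /edge_op cF /=.
have f0 : 0 < (f.+2 * f.+1)%:R :> R by rewrite ltr0n.
rewrite -mulrDl -big_split /= mulrA -(ler_pM2r f0) mulrDl !mulfVK ?lt0r_neq0 //.
have -> : c * (f.+2 * f.+1)%:R = \sum_(a in F) \sum_(b in F :\ a) c.
  under eq_bigr => a aF do rewrite sumr_const (card_setD1 cF aF).
  by rewrite sumr_const cF -mulrnA mulr_natr mulnC.
rewrite mulr_sumr -big_split /=; apply: ler_sum => a aF.
rewrite -big_split mulr_sumr -big_split /=; apply: ler_sum => b bF.
apply: dom; first exact: valid_far_edge.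
by apply: (@card_setD1 _ b _ _ bF); exact: card_setD1 aF.
Qed.

(* [Phi] averaged over [k] random edges and then [m] random messages, from the
   empty graph with all its half-edges free. *)
Definition hybrid (k m : nat) : R :=
  iter k edge_op (iter m msg_op Phi_fun) (fun _ _ => false) [set: half] [::].

Lemma valid_empty : valid (fun _ _ => false) [set: half].
Proof.
split=> // [|v]; first by case=> [|x [|y p]].
rewrite (_ : nbrs _ v = set0) ?cards0 ?add0n; last by apply/setP => y; rewrite !inE.
apply: (@leq_trans #|[set (v, i) | i in [set: 'I_3]]|); last first.
  by apply: leq_trans (leq_imset_card _ _) _; rewrite cardsT card_ord.
apply: subset_leq_card; apply/subsetP => -[x i]; rewrite !inE /= => /eqP->.
by apply/imsetP; exists i; rewrite ?inE.
Qed.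

(** [edge_msg_step] is applied at the end of the process and averaged over all earlier moves;
    commutation then moves the extra edge before the messages. *)
Lemma hybrid_step (k m f0 : nat) : (2 <= f0)%N -> (2 * k + m + f0 <= 3 * #|T|)%N ->
  hybrid k.+1 m + hybrid k m <= 2 * hybrid k m.+1 + step_const f0%:R.
Proof.
move=> f2 le_f; pose f := (3 * #|T| - (2 * k + m))%N.
have le_ff : (f0 <= f)%N by rewrite /f; lia.
have dom0 : dominated f (step_const f0%:R) (edge_op Phi_fun) Phi_fun (msg_op Phi_fun).
  move=> e F s V cF; apply: le_trans (edge_msg_step s V _) _; rewrite cF ?(leq_trans f2) //.
  rewrite lerD2l /step_const lerD2l ler_wpM2l ?mulr_ge0 ?(ltW lnlam0) //.
  by rewrite lef_pV2 ?ler_nat // posrE ltr0n; lia.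
have domm : dominated (f + m) (step_const f0%:R) (iter m msg_op (edge_op Phi_fun))
    (iter m msg_op Phi_fun) (iter m msg_op (msg_op Phi_fun)).
  elim: m {le_f f le_ff} (f) dom0 => [|m IHm] f dom0; first by rewrite addn0.
  by rewrite addnS /=; apply: dominated_msg; exact: IHm.
have domk : dominated (f + m + 2 * k) (step_const f0%:R)
    (iter k edge_op (iter m msg_op (edge_op Phi_fun)))
    (iter k edge_op (iter m msg_op Phi_fun))
    (iter k edge_op (iter m msg_op (msg_op Phi_fun))).
  elim: k {le_f f le_ff dom0} (f) domm => [|k IHk] f domm; first by rewrite addn0.
  by rewrite mulnS addnCA /=; apply: dominated_edge; exact: IHk.
have comm : iter m msg_op (edge_op Phi_fun) = edge_op (iter m msg_op Phi_fun).
  by elim: m {le_f f le_ff dom0 domm domk} => //= m ->; rewrite edge_msg_opC.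
have := domk _ _ [::] valid_empty.
rewrite comm -!iterSr /hybrid /=; apply.
by rewrite cardsT card_prod card_ord /f; lia.
Qed.

End Operators.

(** * The two ends of the interpolation *)

Section Endpoints.

Variables (R : realType) (lam q : R) (T : finType) (g : nat).
Hypotheses (lam1 : 1 < lam) (q0 : 0 < q) (q1 : q < 1).

Local Notation half := (T * 'I_3)%type.
Implicit Types (e : rel T) (s : seq T) (F : {set half}) (a b : half) (u v : T).
Local Notation empty_rel := (fun _ _ : T => false).

Let lam0 : 0 < lam. Proof. exact: lt_trans lam1. Qed.
Let lnlam0 : 0 < ln lam. Proof. exact: ln_gt0. Qed.

Lemma hybrid_ge0 k m : 0 <= hybrid lam q T g k m.
Proof.
have msg0 (G : state_fun R T) : (forall e F s, 0 <= G e F s) -> forall e F s, 0 <= msg_op G e F s.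
  by move=> G0 e F s; rewrite divr_ge0 ?sumr_ge0.
have edge0 (G : state_fun R T) : (forall e F s, 0 <= G e F s) -> forall e F s, 0 <= edge_op g G e F s.
  by move=> G0 e F s; rewrite divr_ge0 ?sumr_ge0 // => a _; rewrite sumr_ge0.
rewrite /hybrid; elim: k (fun _ _ => false) [set: half] [::] => [|k IHk] e F s; last exact: edge0.
by elim: m e F s => [|m IHm] e F s; [exact: Phi_ge0 | exact: msg0].
Qed.

Lemma weight_empty (B : {set T}) :
  weight lam empty_rel B = \prod_v (if v \in B then 1 else 1 + (lam - 1) * 1).
Proof.
rewrite /weight; have -> : alpha_avoid empty_rel B = #|~: B|.
  apply/eqP; rewrite eqn_leq; apply/andP; split.
    apply/bigmax_leqP => S /andP[_]; rewrite disjoints_subset; exact: subset_leq_card.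
  apply: alpha_avoid_max; rewrite /indep_avoid disjoints_subset subxx andbT.
  by apply/forall_inP => x _; apply/forall_inP.
rewrite -prodr_const big_mkcond /=; apply: eq_bigr => v _.
by rewrite inE; case: (v \in B); rewrite //= mulr1 addrC subrK.
Qed.

(** General [c] makes the induction work: a message at [u] multiplies [c u] by [1 - q]. *)
Lemma blockE_prod s (c : T -> R) :
  blockE q s (fun B => \prod_v (if v \in B then 1 else 1 + (lam - 1) * c v)) =
  \prod_v (1 + (lam - 1) * (c v * (1 - q) ^+ count_mem v s)).
Proof.
elim: s c => [|u s IHs] c /=.
  by apply: eq_bigr => v _; rewrite inE mulr1.
pose c' v := if v == u then c v * (1 - q) else c v.
transitivity (\prod_v (1 + (lam - 1) * (c' v * (1 - q) ^+ count_mem v s))).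
  rewrite -IHs; apply: eq_blockE => B; rewrite !(bigD1 u (P := predT)) //=.
  rewrite /c' eqxx !inE eqxx /=.
  have rest (B' : {set T}) (d : T -> R) : (forall v, v != u -> (v \in B') = (v \in B) /\ d v = c v) ->
      \prod_(v | v != u) (if v \in B' then 1 else 1 + (lam - 1) * d v) =
      \prod_(v | v != u) (if v \in B then 1 else 1 + (lam - 1) * c v).
    by move=> eqd; apply: eq_bigr => v /eqd[-> ->].
  rewrite (rest (u |: B) c); last by move=> v vu; rewrite !inE (negbTE vu).
  rewrite [in RHS](rest B); last by move=> v /negbTE->.
  by case: (u \in B); ring.
apply: eq_bigr => v _; rewrite /c' (eq_sym u); case: (v == u); last by rewrite add0n.
by rewrite add1n exprS -!mulrA.
Qed.

Local Notation vertex_const := (1 + (lam - 1) * (1 - q) ^+ 3).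

Let q10 : 0 < 1 - q. Proof. by rewrite subr_gt0. Qed.

Let A1 : 1 <= vertex_const.
Proof. by rewrite lerDl mulr_ge0 ?exprn_ge0 ?subr_ge0 ?ltW. Qed.

(** A vertex with three messages contributes [vertex_const]; any other contributes at most [lam],
    charged to one of its free half-edges. *)
Lemma Phi_empty_le F s :
  (forall v, count_mem v s + #|[set a in F | a.1 == v]| = 3)%N ->
  Phi lam q empty_rel s <= #|T|%:R * ln vertex_const + #|F|%:R * ln lam.
Proof.
move=> cF.
have A0 : 0 < vertex_const by exact: lt_le_trans A1.
have ZE : blockE q s (weight lam empty_rel) =
    \prod_v (1 + (lam - 1) * (1 - q) ^+ count_mem v s).
  under eq_blockE do rewrite weight_empty.
  by rewrite blockE_prod; apply: eq_bigr => v _; rewrite mul1r.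
have Zle : blockE q s (weight lam empty_rel) <= vertex_const ^+ #|T| * lam ^+ #|F|.
  rewrite ZE; have -> : vertex_const ^+ #|T| * lam ^+ #|F| =
      \prod_v (vertex_const * lam ^+ #|[set a in F | a.1 == v]|).
    rewrite big_split /= prodr_const prodrXr; congr (_ * _ ^+ _).
    rewrite -sum1_card (partition_big fst predT) //=; apply: eq_bigr => v _.
    by rewrite sum1dep_card.
  apply: ler_prod => v _; apply/andP; split.
    by rewrite addr_ge0 // mulr_ge0 ?exprn_ge0 ?subr_ge0 ?ltW.
  have := cF v; case: #|_| => [|p] /=; first by rewrite addn0 => ->; rewrite mulr1.
  move=> _; apply: (@le_trans _ _ lam).
    rewrite -lerBrDl ler_piMr ?subr_ge0 ?(ltW lam1) // exprn_ile1 ?(ltW q10) //.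
    by rewrite gerBl ltW.
  apply: (@le_trans _ _ (lam ^+ p.+1)); first by rewrite exprS ler_peMr ?(ltW lam0) // exprn_ege1 // ltW.
  by rewrite ler_peMl // exprn_ge0 // ltW.
have Z1 := blockE_weight_ge1 lam1 q0 q1 empty_rel s.
rewrite /Phi; apply: (@le_trans _ _ (ln (vertex_const ^+ #|T| * lam ^+ #|F|))).
  by rewrite ler_ln ?posrE ?mulr_gt0 ?exprn_gt0 // (lt_le_trans _ Z1).
by rewrite lnM ?posrE ?exprn_gt0 // !lnXn // !mulr_natl.
Qed.

Lemma iter_msg_empty_le m F s :
  (forall v, count_mem v s + #|[set a in F | a.1 == v]| = 3)%N -> (m <= #|F|)%N ->
  iter m (@msg_op R T) (@Phi_fun R lam q T) empty_rel F s <=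
  #|T|%:R * ln vertex_const + (#|F| - m)%:R * ln lam.
Proof.
elim: m F s => [|m IHm] F s cF mF; first by rewrite subn0; exact: Phi_empty_le.
rewrite /= {1}/msg_op ler_pdivrMr ?ltr0n ?(leq_trans _ mF) // mulr_natr -sumr_const.
apply: ler_sum => a aF.
have cFa : #|F :\ a| = #|F|.-1 by rewrite (cardsD1 a F) aF.
have -> : (#|F| - m.+1 = #|F :\ a| - m)%N by rewrite cFa; lia.
apply: IHm => [v|]; last by rewrite cFa; lia.
rewrite -[RHS](cF v) /= (cardsD1 a [set x in F | x.1 == v]) !inE aF /= addnCA -!addnA; congr (_ + (_ + _))%N.
by apply: eq_card => x; rewrite !inE andbA.
Qed.

Lemma hybrid0_le m : (m <= 3 * #|T|)%N ->
  hybrid lam q T g 0 m <= #|T|%:R * ln vertex_const + (3 * #|T| - m)%:R * ln lam.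
Proof.
have -> : (3 * #|T| = #|[set: half]|)%N by rewrite cardsT card_prod card_ord mulnC.
apply: iter_msg_empty_le => v /=; rewrite add0n.
have -> : [set a in [set: half] | a.1 == v] = finset.setX [set v] [set: 'I_3].
  by apply/setP => -[x i]; rewrite !inE andbT.
by rewrite cardsX cards1 cardsT card_ord.
Qed.

(** A bound valid for all outcomes passes to the average. The size condition avoids averages over an
    empty set, which would be 0. *)
Lemma iter_edge_ge (theta : R) s k e F :
  (forall e' F', valid g e' F' -> theta <= Phi lam q e' s) ->
  valid g e F -> (2 * k <= #|F|)%N ->
  theta <= iter k (@edge_op R T g) (@Phi_fun R lam q T) e F s.
Proof.
move=> low; elim: k e F => [|k IHk] e F V kF; first exact: low V.
have F2 : (2 <= #|F|)%N by rewrite (leq_trans _ kF) // leq_pmulr.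
rewrite /= {1}/edge_op ler_pdivlMr; last by rewrite ltr0n; clear -F2; lia.
rewrite natrM mulrCA mulr_natl -sumr_const; apply: ler_sum => a aF.
have cFa : #|F :\ a| = #|F|.-1 by rewrite (cardsD1 a F) aF.
rewrite -cFa mulr_natr -sumr_const; apply: ler_sum => b bF.
apply: IHk; first exact: valid_far_edge.
by have := cardsD1 b (F :\ a); rewrite bF cFa; clear -kF; lia.
Qed.

End Endpoints.

(* The penalty keeps the free pool [M - 2 k - m] close to its initial size, so
   that the recursive inequality stays applicable all along. *)
Lemma descent (R : realFieldType) (a : nat -> nat -> R) (M N f0 : nat) (c delta : R) :
  (forall k m, 0 <= a k m) ->
  (forall k m, (2 * k + m + f0 <= M)%N -> a k.+1 m + a k m <= 2 * a k m.+1 + c) ->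
  (N + f0 <= M)%N -> 0 < delta -> 0 <= c ->
  a 0%N N + N%:R * (c / 2 + delta) < delta * ((M - N - f0)%:R) ^+ 2 ->
  exists2 k, (2 * k <= M)%N & a k 0%N <= a 0%N N + N%:R * (c / 2 + delta).
Proof.
move=> a0 step NM d0 c0 big.
(* The deviation of the free pool from its size at the start [(0, N)]. *)
pose x k m : R := M%:R - 2 * k%:R - m%:R - (M - N)%:R.
have NM' : (N <= M)%N by lia.
(* A pool below [f0] would incur a penalty beyond the whole budget. *)
have pool k m : (m <= N)%N -> a k m + delta * x k m ^+ 2 <= a 0%N N + N%:R * (c / 2 + delta) ->
    (2 * k + m + f0 <= M)%N.
  move=> mN le.
  have : delta * x k m ^+ 2 < delta * ((M - N - f0)%:R) ^+ 2.
    by apply: le_lt_trans big; apply: le_trans le; rewrite lerDr.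
  rewrite ltr_pM2l // => lt_sq; rewrite leqNgt; apply/negP => lt_M.
  have : (M - N - f0)%:R <= - x k m.
    rewrite /x !natrB //; try lia.
    move: lt_M; rewrite -(ltr_nat R) [(_ + f0)%:R]natrD [(_ + m)%:R]natrD natrM; lra.
  have : 0 <= (M - N - f0)%:R :> R by [].
  nra.
suff walk i : (i <= N)%N -> exists k,
    a k (N - i)%N + delta * x k (N - i)%N ^+ 2 <= a 0%N N + i%:R * (c / 2 + delta).
  have [k le] := walk N (leqnn N); rewrite subnn in le; exists k.
    by have := pool _ _ (leq0n N) le; lia.
  by apply: le_trans le; rewrite lerDl mulr_ge0 ?sqr_ge0 // ltW.
elim: i => [_|i IHi iN].
  exists 0%N; rewrite subn0 mul0r addr0 /x natrB // mulr0 subr0.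
  by rewrite (_ : _ - _ - _ = 0) ?expr0n ?mulr0 ?addr0 //; ring.
have [k le] := IHi (ltnW iN).
have leN : a k (N - i)%N + delta * x k (N - i)%N ^+ 2 <= a 0%N N + N%:R * (c / 2 + delta).
  apply: le_trans le _; rewrite lerD2l ler_wpM2r ?ler_nat ?(ltnW iN) //.
  by rewrite addr_ge0 ?(ltW d0) ?divr_ge0.
have := pool _ _ (leq_subr _ _) leN; have -> : (N - i = (N - i.+1).+1)%N by lia.
move=> le_M; have := step k (N - i.+1)%N; have -> : (2 * k + (N - i.+1) + f0 <= M)%N by lia.
move=> /(_ isT); move: le; have -> : (N - i = (N - i.+1).+1)%N by lia.
move: (N - i.+1)%N => m; have xE : x k m.+1 = x k m - 1 by rewrite /x -[m.+1%:R]natr1; ring.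
have xE' : x k.+1 m = x k m - 2 by rewrite /x -[k.+1%:R]natr1; ring.
rewrite xE -[i.+1%:R]natr1 => le le2.
(* Dropping a message shifts the deviation by 1, trading it for an edge by -1. The average of the
   two penalized values grows by at most [c / 2 + delta], so one of the moves is affordable. *)
have [leA|ltA] := lerP (a k m + delta * x k m ^+ 2) (a 0%N N + (i%:R + 1) * (c / 2 + delta)).
  by exists k.
exists k.+1; rewrite xE'; nra.
Qed.

(** * Cubic graphs of large girth with small independence ratio *)

Lemma pool_arith (n r : nat) : (r <= n)%N ->
  [/\ (3 * n - (3 * n - 2 * r) = 2 * r)%N, (3 * n - (3 * n - 2 * r) - r = r)%N
    & (3 * n - 2 * r + r <= 3 * n)%N].
Proof. by move=> rn; split; lia. Qed.

Lemma sparse_graph (R : realType) (lam q rho : R) (g : nat) :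
  1 < lam -> 0 < q -> q < 1 ->
  ln (1 + (lam - 1) * (1 - q) ^+ 3) - 3 / 2 * ln (1 - (1 - lam^-1) * q ^+ 2) < rho * ln lam ->
  exists (n : nat) (e : rel 'I_n), [/\ (0 < n)%N, symmetric e, irreflexive e,
    girth_at_least e g & (forall v, #|nbrs e v| <= 3)%N] /\ (alpha e)%:R <= rho * n%:R.
Proof.
move=> lam1 q0 q1 gap.
have lam0 : 0 < lam by exact: lt_trans lam1.
have l0 : 0 < ln lam by exact: ln_gt0.
set lA := ln (1 + _) in gap; pose C := - ln (1 - (1 - lam^-1) * q ^+ 2).
pose gam := rho * ln lam - (lA + 3 / 2 * C).
have gam0 : 0 < gam by rewrite /gam /C; lra.
have C0 : 0 <= C.
  rewrite oppr_ge0 ln_le0 // gerBl mulr_ge0 ?sqr_ge0 // subr_ge0 invf_le1 // ltW //.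
have lA0 : 0 <= lA by rewrite ln_ge0 // lerDl mulr_ge0 ?exprn_ge0 ?subr_ge0 ?ltW.
pose nb : R := (near_bound g)%:R.
have nb0 : 0 <= nb by [].
(* The slack [n * gam] is spent in quarters: on penalties through [delta], on half-edges initially
   free through [L], on step errors through [r2]. *)
pose delta := gam / 12.
have delta0 : 0 < delta by rewrite divr_gt0.
have big (x : R) : exists2 k : nat, (0 < k)%N & x <= k%:R.
  exists (Num.bound `|x|).+1 => //; apply: le_trans (ler_norm x) _.
  by apply: ltW; apply: lt_trans (archi_boundP (normr_ge0 x)) _; rewrite ltr_nat.
have [L L0 leL] := big (8 * ln lam / gam).
(* [K * r] bounds the budget of [descent]; [r1] keeps it below the penalty [delta * r ^+ 2] of a
   pool shrunk from [2 * r] to [r]. *)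
pose K := L%:R * lA + 2 * ln lam + 3 * L%:R * (C / 2 + nb * ln lam + delta).
have [r1 r10 ler1] := big (K / delta).
have [r2 r20 ler2] := big (6 * nb * ln lam / gam).
pose r := (r1 + r2)%N; pose n := (L * r)%N; pose N := (3 * n - 2 * r)%N.
have r_ge2 : (2 <= r)%N := leq_add r10 r20.
have r_le_n : (r <= n)%N by rewrite /n leq_pmull.
have [poolE1 poolE2 poolE3] := pool_arith r_le_n.
have rR : 2 <= r%:R :> R by rewrite (ler_nat R 2).
have cardn : #|'I_n| = n by exact: card_ord.
pose a k m := hybrid lam q 'I_n g k m.
pose c := step_const lam q g (r%:R : R).
have cE : c = C + nb * ln lam / r%:R by [].
have c0 : 0 <= c by rewrite cE addr_ge0 ?divr_ge0 ?mulr_ge0 // ltW.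
have NR : N%:R <= 3 * n%:R :> R by rewrite -natrM ler_nat leq_subr.
have aN : a 0%N N <= n%:R * lA + 2 * r%:R * ln lam.
  have NM : (N <= 3 * #|'I_n|)%N by rewrite cardn leq_subr.
  apply: le_trans (hybrid0_le g lam1 q0 q1 NM) _.
  by rewrite cardn poolE1 natrM.
have nE : n%:R = L%:R * r%:R :> R by rewrite natrM.
have rV : r%:R * (r%:R^-1) = 1 :> R by rewrite mulfV // lt0r_neq0 //; lra.
have n0 : 0 < n%:R :> R by rewrite ltr0n (leq_trans _ r_le_n) // (leq_trans _ r_ge2).
have Nc : N%:R * (c / 2 + delta) <= 3 * n%:R * (c / 2 + delta).
  by rewrite ler_wpM2r // addr_ge0 ?divr_ge0 // ltW.
have ncE : n%:R * c = n%:R * C + L%:R * (nb * ln lam).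
  by rewrite cE mulrDr; congr (_ + _); rewrite nE; field; rewrite lt0r_neq0 //; lra.
have nbl0 : 0 <= nb * ln lam by rewrite mulr_ge0 // ltW.
have penalty : a 0%N N + N%:R * (c / 2 + delta) < delta * ((3 * n - N - r)%:R) ^+ 2.
  rewrite poolE2.
  have r1r : r1%:R < r%:R :> R by rewrite ltr_nat -addn1 leq_add2l.
  have Kr : K < delta * r%:R by rewrite mulrC -ltr_pdivrMr //; exact: le_lt_trans r1r.
  apply: (@le_lt_trans _ _ (K * r%:R)); last by rewrite expr2 mulrA ltr_pM2r // (lt_le_trans _ rR).
  have Lr : L%:R * (nb * ln lam) <= L%:R * (nb * ln lam) * r%:R.
    by rewrite ler_peMr ?mulr_ge0 //; lra.
  move: aN Nc ncE Lr; rewrite /K nE; nra.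
have [] := descent (a := a) (M := (3 * n)%N) (N := N) (f0 := r) (c := c) _ _ _ delta0 c0 penalty.
- by move=> k m; exact: hybrid_ge0.
- by move=> k m le_f; apply: hybrid_step => //; rewrite cardn.
- exact: poolE3.
move=> k kM ak.
have akl : a k 0%N < rho * n%:R * ln lam.
  apply: le_lt_trans ak _.
  have t1 : 2 * r%:R * ln lam <= n%:R * gam / 4.
    move: leL; rewrite ler_pdivrMr // nE => leL.
    have := ler_wpM2l (ler0n R r) leL; lra.
  have t2 : L%:R * (nb * ln lam) * (3 / 2) <= n%:R * gam / 4.
    have r2r : r2%:R <= r%:R :> R by rewrite ler_nat leq_addl.
    have := le_trans ler2 r2r; rewrite ler_pdivrMr // nE => le6.
    have := ler_wpM2l (ler0n R L) le6; lra.
  have t3 : n%:R * gam = n%:R * (rho * ln lam) - n%:R * (lA + 3 / 2 * C).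
    by rewrite -mulrBr.
  have t4 : 0 < n%:R * gam by rewrite mulr_gt0.
  have t5 : 3 * n%:R * (c / 2 + delta) = 3 / 2 * (n%:R * C) + 3 / 2 * (L%:R * (nb * ln lam)) + n%:R * gam / 4.
    have -> : 3 * n%:R * (c / 2 + delta) = 3 / 2 * (n%:R * c) + 3 * n%:R * delta by lra.
    rewrite ncE /delta; lra.
  lra.
(* Some outcome lies below the strict bound on the average; with no messages left, its [Phi] is the
   independence number times [ln lam]. *)
have [[e [F [V ltP]]]|none] := pselect (exists e F, valid g e F /\
    Phi lam q (e : rel 'I_n) [::] < rho * n%:R * ln lam).
  exists n, e; case: V => sym irr G deg; split.
    split=> //; first by rewrite (leq_trans _ r_le_n) // (leq_trans _ r_ge2).
    by move=> v; apply: leq_trans (deg v); exact: leq_addr.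
  by move: ltP; rewrite Phi_nil // ltr_pM2r // => /ltW.
have : rho * n%:R * ln lam <= a k 0%N.
  apply: iter_edge_ge; last by rewrite cardsT card_prod !card_ord [(n * 3)%N]mulnC.
    by move=> e F V; rewrite leNgt; apply/negP => ltP; apply: none; exists e, F.
  exact: valid_empty.
by rewrite leNgt akl.
Qed.

Section CubicGraphs.

(** Exponentiating reduces a numerical bound on logarithms to a computation with integers. *)
Lemma ln_ratio_le (R : realType) (a b c d m i j k : nat) :
  (0 < a)%N -> (0 < b)%N -> (0 < c)%N -> (0 < d)%N -> (0 < m)%N ->
  (a ^ i * d ^ k <= m ^ j * c ^ k * b ^ i)%N ->
  ln (a%:R / b%:R) * i%:R <= ln m%:R * j%:R + ln (c%:R / d%:R) * k%:R :> R.
Proof.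
rewrite -!(ltr0n R) => a0 b0 c0 d0 m0 le.
have ab0 : 0 < a%:R / b%:R :> R by exact: divr_gt0.
have cd0 : 0 < c%:R / d%:R :> R by exact: divr_gt0.
rewrite !mulr_natr -!lnXn // -lnM ?posrE ?exprn_gt0 // ler_ln ?posrE ?mulr_gt0 ?exprn_gt0 //.
rewrite !expr_div_n ler_pdivrMr ?exprn_gt0 // mulrAC mulrA ler_pdivlMr ?exprn_gt0 //.
by rewrite -!natrX -!natrM ler_nat mulnAC.
Qed.

(* Any fraction below [908 / 1000] and above the left-hand side over [ln 11]
   would do in place of [28 / 31]. *)
Lemma replica_bound_lt (R : realType) : ln (1 + (11 - 1) * (1 - 5 / 8) ^+ 3)
  - 3 / 2 * ln (1 - (1 - 11^-1) * (5 / 8) ^+ 2) < 454 / 1000 * ln 11 :> R.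
Proof.
have -> : 1 + (11 - 1) * (1 - 5 / 8) ^+ 3 = 391 / 256 :> R by field.
have -> : 1 - (1 - 11^-1) * (5 / 8) ^+ 2 = 227 / 352 :> R by field.
have l0 : 0 < ln 11 :> R by apply: ln_gt0; lra.
(* Multiplication by 62 turns the coefficients 1 and 3/2 into 62 and 93, and 28/62 is less than
   454/1000. *)
have := @ln_ratio_le R 391 256 227 352 11 62 28 93 isT isT isT isT isT.
have -> : (391 ^ 62 * 352 ^ 93 <= 11 ^ 28 * 227 ^ 93 * 256 ^ 62)%N by lia.
move=> /(_ isT); lra.
Qed.

Local Notation R := Rdefinitions.R.

Lemma sparse_cubic_graph (g : nat) :
  exists2 x : R, ratio_set 3 g x & x <= 454 / 1000.
Proof.
have lam1 : 1 < 11 :> R by lra.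
have q0 : 0 < 5 / 8 :> R by lra.
have q1 : 5 / 8 < 1 :> R by lra.
have [n [e [[n0 sym irr G deg] small]]] := sparse_graph g lam1 q0 q1 (replica_bound_lt _).
have [T' [e' [m [[simple reg G'] [m0 cT le_a]]]]] := cubic_completion sym irr deg G.
rewrite card_ord in cT.
have T0 : (0 < #|T'|)%N by rewrite cT muln_gt0 m0.
exists (Rdiv (INR (alpha e')) (INR (nverts T'))).
  by exists T', e'; split=> //; split=> //; split=> //; split=> //; apply/ssrnat.ltP.
rewrite RdivE !INRE /nverts ler_pdivrMr ?ltr0n // cT natrM mulrCA.
apply: (@le_trans _ _ (m%:R * (alpha e)%:R)); first by rewrite -natrM ler_nat.
by rewrite ler_wpM2l.
Qed.

End CubicGraphs.

(** * The infima and their limit *)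

Open Scope R_scope.

Lemma cubic_small_ratio (g : nat) : exists2 x : R, ratio_set 3 g x & x <= 454 / 1000.
Proof.
have [x rx /RleP le_x] := sparse_cubic_graph g; exists x => //.
by move: le_x; rewrite -RdivE -!INRE !INR_IZR_INZ.
Qed.

Lemma ratio_set_ge0 r g x : ratio_set r g x -> 0 <= x.
Proof.
move=> [T [e [_ [_ [_ [T0 ->]]]]]]; apply: Rmult_le_pos; first exact: pos_INR.
by apply/Rlt_le/Rinv_0_lt_compat/lt_0_INR/ssrnat.ltP.
Qed.

(** Completeness gives suprema, hence the reflected set; the graphs just built make it nonempty. *)
Lemma ratio_set_inf (g : nat) : {m : R | is_inf (ratio_set 3 g) m}.
Proof.
have [||m [ub lub]] := completeness (fun y => ratio_set 3 g (- y)).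
- exists 0 => y /ratio_set_ge0 y0; apply: Ropp_le_cancel; rewrite Ropp_0; exact: y0.
- have [x rx _] := cubic_small_ratio g; by exists (- x); rewrite Ropp_involutive.
exists (- m); split=> [x rx|b low]; apply: Ropp_le_cancel; rewrite Ropp_involutive.
  by apply: ub; rewrite Ropp_involutive.
by apply: lub => y /low; rewrite -{1}(Ropp_involutive b); exact: Ropp_le_cancel.
Qed.

(* i(3,g) is the infimum f g of ratio_set 3 g; i(3,oo) = lim_g i(3,g) exists and is <= 0.454. *)
Theorem theorem2 :
  exists f : nat -> R,
    (forall g : nat, is_inf (ratio_set 3 g) (f g)) /\
    exists l : R, Un_cv f l /\ l <= 454 / 1000.
Proof.
pose f g := proj1_sig (ratio_set_inf g).
have inf_f g : is_inf (ratio_set 3 g) (f g) := proj2_sig (ratio_set_inf g).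
exists f; split=> //.
have f_le g : f g <= 454 / 1000.
  have [x rx le_x] := cubic_small_ratio g.
  by have [low _] := inf_f g; exact: Rle_trans (low x rx) le_x.
(* Raising the girth bound shrinks the set of ratios, so the infima increase, and the common bound
   makes them converge. *)
have f_grow : Un_growing f.
  move=> g; have [_ lub] := inf_f g.+1; apply: lub => x [T [e [S [reg [G [T0 ->]]]]]].
  have [low _] := inf_f g; apply: low; exists T, e; split=> //; split=> //; split=> //.
  exact: girth_leq G.
have [|l cv] := growing_cv f f_grow.
  by exists (454 / 1000) => _ [g ->].
exists l; split=> //; apply: Rle_cv_lim f_le cv _ => eps eps0; exists 0%nat => n _.
by rewrite /Rdist Rminus_diag Rabs_R0.
Qed.
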